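(* Let $G$ be a graph and let $S=(s_1,s_2,\dots)$ be an infinite non-increasing sequence of positive integers that is realized by $G$. Then $\varphi_S(G)\le m_S(G)$.
   Context: Graphs are finite, simple and connected; $d_G(x)$ is the degree of $x$. Given a proper coloring of $G$, a vertex $v$ is a color-dominating vertex (CDV) if its closed neighborhood $N[v]$ contains all colors used in the coloring. A b-coloring is a proper coloring in which every color class contains at least one CDV. $G$ realizes a finite sequence $(s_1,\dots,s_k)$, $k\ge1$, if $G$ has a b-coloring with exactly $k$ colors in which, for each $i\in\{1,\dots,k\}$, the $i$th color class contains at least $s_i$ CDVs. $G$ realizes an infinite sequence $S$ if it realizes $(s_1,\dots,s_k)$ for at least one $k\ge1$; in that case $\varphi_S(G)$ is the maximum such $k$. For an integer $k$, let $n_k(G)=|\{x\in V(G): d_G(x)\ge k-1\}|$. The sequential $m$-degree of $G$ with respect to $S$ is $m_S(G)=\max\{k:\ \sum_{i=1}^k s_i\le n_k(G)\}$. *)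

(* Defs.v *)
From mathcomp Require Import all_boot.

Set Implicit Arguments.
Unset Strict Implicit.
Unset Printing Implicit Defensive.

Record sgraph := SGraph {
  vertex :> finType;
  adj : rel vertex;
  adj_sym : symmetric adj;
  adj_irrefl : irreflexive adj }.

Definition connected (G : sgraph) : Prop :=
  0 < #|G| /\ forall x y : G, connect (@adj G) x y.

Definition nbh (G : sgraph) (x : G) : {set G} := [set y | adj x y].

Definition closed_nbh (G : sgraph) (x : G) : {set G} := x |: nbh x.

Definition degree (G : sgraph) (x : G) : nat := #|nbh x|.

Definition proper (G : sgraph) (k : nat) (c : {ffun G -> 'I_k}) : bool :=
  [forall x : G, forall y : G, adj x y ==> (c x != c y)].

Definition color_dominating (G : sgraph) (k : nat) (c : {ffun G -> 'I_k})
    (v : G) : bool :=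
  c @: [set: G] \subset c @: closed_nbh v.

Definition class_cdvs (G : sgraph) (k : nat) (c : {ffun G -> 'I_k})
    (i : 'I_k) : {set G} :=
  [set v | (c v == i) && color_dominating c v].

(* The second condition makes every class nonempty, so that such a c uses
   exactly k colors. *)
Definition b_coloring (G : sgraph) (k : nat) (c : {ffun G -> 'I_k}) : bool :=
  proper c && [forall i : 'I_k, class_cdvs c i != set0].

Definition realizes (G : sgraph) (k : nat) (s : k.-tuple nat) : bool :=
  [exists c : {ffun G -> 'I_k},
    b_coloring c && [forall i : 'I_k, tnth s i <= #|class_cdvs c i|]].

(* An infinite sequence (s_1, s_2, ...) is S : nat -> nat with s_i = S i.-1. *)
Definition prefix_of (S : nat -> nat) (k : nat) : k.-tuple nat :=
  [tuple S i | i < k].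

Definition realizes_inf (G : sgraph) (S : nat -> nat) : Prop :=
  exists2 k : nat, 0 < k & realizes G (prefix_of S k).

(* For k = 0 the truncated k.-1 gives the same set as the integer -1. *)
Definition num_deg_ge (G : sgraph) (k : nat) : nat :=
  #|[set x : G | k.-1 <= degree x]|.

(* In both maxima below, bounding k by the order of G loses nothing; see phi_max
   and mdeg_max. *)
Definition phi (G : sgraph) (S : nat -> nat) : nat :=
  \max_(k < #|G|.+1 | (0 < k) && realizes G (prefix_of S k)) k.

Definition mdeg (G : sgraph) (S : nat -> nat) : nat :=
  \max_(k < #|G|.+1 | \sum_(i < k) S i <= num_deg_ge G k) k.

Lemma bigmax_bounded (P : pred nat) (n : nat) :
  (exists k, P k) -> (forall k, P k -> k <= n) ->
  P (\max_(k < n.+1 | P k) k) /\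
  forall k, P k -> k <= \max_(k < n.+1 | P k) k.
Proof.
move=> [k0 Pk0] bP; split; last first.
  move=> k Pk; have kn : k < n.+1 by rewrite ltnS bP.
  exact: (@leq_bigmax_cond _ (fun i : 'I_n.+1 => P i) (fun i => nat_of_ord i)
            (Ordinal kn)).
have kn : k0 < n.+1 by rewrite ltnS bP.
by rewrite (@bigop.bigmax_eq_arg _ (Ordinal kn)) //; case: arg_maxnP.
Qed.

Lemma realizes_leq_order (G : sgraph) (k : nat) (s : k.-tuple nat) :
  realizes G s -> k <= #|G|.
Proof.
case/existsP=> c /andP[/andP[_ /forallP cdvs] _].
have surj (i : 'I_k) : i \in codom c.
  have /set0Pn[v] := cdvs i; rewrite inE => /andP[/eqP <- _].
  exact: codom_f.
rewrite -[k]card_ord -(eq_card (_ : codom c =i 'I_k)); first exact: leq_image_card.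
by move=> i; rewrite surj.
Qed.

Lemma phi_max (G : sgraph) (S : nat -> nat) : realizes_inf G S ->
  [/\ 0 < phi G S, realizes G (prefix_of S (phi G S)) &
      forall k, 0 < k -> realizes G (prefix_of S k) -> k <= phi G S].
Proof.
case=> k k0 rk.
have [|j /andP[_ /realizes_leq_order]//|/andP[] ? ? ub] :=
  @bigmax_bounded (fun k => (0 < k) && realizes G (prefix_of S k)) #|G|.
  by exists k; rewrite k0.
by split=> // j j0 rj; apply: ub; rewrite j0.
Qed.

Lemma mdeg_max (G : sgraph) (S : nat -> nat) : (forall i, 0 < S i) ->
  \sum_(i < mdeg G S) S i <= num_deg_ge G (mdeg G S) /\
  forall k, \sum_(i < k) S i <= num_deg_ge G k -> k <= mdeg G S.
Proof.
move=> S_gt0.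
apply: (@bigmax_bounded (fun k => \sum_(i < k) S i <= num_deg_ge G k)).
  by exists 0; rewrite big_ord0.
move=> k /leq_trans-/(_ _ (max_card _)); apply: leq_trans.
by rewrite -{1}[k]card_ord -sum1_card leq_sum.
Qed.

(* Main.v *)
(* A color-dominating vertex of a b-coloring with k colors sees the k - 1 other
   colors, so its degree is at least k - 1. The color classes are disjoint, hence
   a realization of (s_1, ..., s_k) exhibits at least s_1 + ... + s_k vertices of
   degree at least k - 1. *)
Require Import Defs.
From mathcomp Require Import all_boot.

(** Every class contains a CDV, so every color is used, and domination means seeing all [k]
    colors. *)
Lemma imset_b_coloring (G : sgraph) (k : nat) (c : {ffun G -> 'I_k}) :
  b_coloring c -> c @: [set: G] = [set: 'I_k].
Proof.
case/andP=> _ /forallP cdvs; apply/setP=> i; rewrite [RHS]inE.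
have /set0Pn[v] := cdvs i; rewrite inE => /andP[/eqP <- _].
by rewrite imset_f ?inE.
Qed.

Lemma color_dominating_degree (G : sgraph) (k : nat) (c : {ffun G -> 'I_k})
    (v : G) :
  b_coloring c -> color_dominating c v -> k.-1 <= degree v.
Proof.
move=> c_b; rewrite /color_dominating (imset_b_coloring _ _ _ c_b).
move=> /subset_leq_card; rewrite cardsT card_ord => k_le.
have {k_le} := leq_trans k_le (leq_imset_card _ _).
(* As [v] is not its own neighbor, [closed_nbh v] has [degree v + 1] vertices; splitting on [k]
   handles the truncated [k.-1]. *)
by rewrite cardsU1 inE adj_irrefl; case: k c c_b.
Qed.

Lemma realizes_sum_leq (G : sgraph) (k : nat) (s : k.-tuple nat) :
  realizes G s -> \sum_(i < k) tnth s i <= num_deg_ge G k.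
Proof.
case/existsP=> c /andP[c_b /forallP s_le].
apply: (@leq_trans (\sum_(i < k) #|class_cdvs c i|)).
  by apply: leq_sum => i _; apply: s_le.
(* Group the color-dominating vertices by their color. *)
have -> : \sum_(i < k) #|class_cdvs c i| = #|[set v | color_dominating c v]|.
  rewrite -sum1_card (partition_big c xpredT) //=.
  apply: eq_bigr => i _; rewrite -sum1_card.
  by apply: eq_bigl => v; rewrite !inE andbC.
apply/subset_leq_card/subsetP=> v; rewrite !inE.
exact: color_dominating_degree.
Qed.

Theorem proposition2p7 (G : sgraph) (G_conn : connected G) (S : nat -> nat)
    (S_pos : forall i : nat, 0 < S i)
    (S_noninc : forall i j : nat, i <= j -> S j <= S i)
    (S_real : realizes_inf G S) :
  phi G S <= mdeg G S.
Proof.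
have [_ /realizes_sum_leq phi_real _] := phi_max S_real.
(* By maximality of [mdeg G S], it suffices that [phi G S] satisfies its defining inequality. *)
apply: (mdeg_max G S_pos).2; apply: leq_trans phi_real.
by apply: leq_sum => i _; rewrite tnth_mktuple.
Qed.
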